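(* Let $k$ be a field. There exist a constant $C>0$ and a sequence $(R^{(j)})_{j\geq 1}$ of finitely generated monomial $k$-algebras with $H(R^{(j)})>1$ for all $j$ and $\lim_{j\to\infty}H(R^{(j)})=1$, such that for every $j$ there are two monomials $a_j,b_j\in R^{(j)}$, each of degree at most $\frac{C}{\log_2 H(R^{(j)})}$, which freely generate a free (noncommutative, rank two) subalgebra of $R^{(j)}$.
   Context: A monomial algebra is a quotient of a free associative algebra $k\langle x_1,\dots,x_d\rangle$ by an ideal generated by monomials; it is graded by $\deg(x_i)=1$ for every letter $x_i$. For a graded $k$-algebra $R=\bigoplus_{i\geq 0}R_i$ with $\dim_k R_i<\infty$ for all $i$, the entropy of $R$ is $H(R)=\limsup_{n\to\infty}\sqrt[n]{\dim_k\bigoplus_{i\leq n}R_i}$. *)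

(* Defs.v *)
From HB Require Import structures.
From mathcomp Require Import all_boot all_order all_algebra.
From mathcomp Require Import generic_quotient.
From mathcomp Require Import all_classical all_reals all_analysis.
(* The notations of monalg clash with those of mathcomp-analysis. *)
From mathcomp.multinomials Require Import -(notations) monalg.

Set Implicit Arguments.
Unset Strict Implicit.
Unset Printing Implicit Defensive.

Import Order.TTheory GRing.Theory Num.Theory.
Import numFieldNormedType.Exports.

Local Open Scope classical_set_scope.
Local Open Scope quotient_scope.
Local Open Scope ring_scope.

(* The free associative unital algebra k<x_i | i in I>: the monoid algebra over
   k of the free monoid fmonom I of words over I. *)
Notation free_algebra k I := (malg (fmonom I) k).

Definition word (k : fieldType) (I : choiceType) (w : fmonom I) :
  free_algebra k I := mkmalgU w 1.

Definition two_sided_ideal (A : pzRingType) (J : set A) : Prop :=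
  [/\ J 0, forall x y, J x -> J y -> J (x - y)
    & forall a x b, J x -> J (a * x * b)].

Definition generated_ideal (A : pzRingType) (S : set A) : set A :=
  smallest (@two_sided_ideal A) S.

(* A set of defining monomials in d letters.  It may be infinite, but the empty
   word is excluded: it would give the zero ring, which is not an algType. *)
Record monomial_relations (d : nat) := MonomialRelations {
  relations :> set (fmonom 'I_d);
  relations_neq1 : ~ relations mone
}.

Section MonomialAlgebra.
Variables (k : fieldType) (d : nat) (W : monomial_relations d).

Definition monomial_ideal : set (free_algebra k 'I_d) :=
  generated_ideal [set word k w | w in (W : set _)].

Lemma monomial_idealP : two_sided_ideal monomial_ideal.
Proof.
split=> [J [[]]//|x y Jx Jy J CJ|a x b Jx J CJ].
  by have [[_ + _] _] := CJ; apply; [exact: Jx|exact: Jy].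
by have [[_ _ +] _] := CJ; apply; exact: Jx.
Qed.

Lemma monomial_ideal0 : monomial_ideal 0.
Proof. by have [] := monomial_idealP. Qed.

Lemma monomial_idealB x y :
  monomial_ideal x -> monomial_ideal y -> monomial_ideal (x - y).
Proof. by have [_ + _] := monomial_idealP; apply. Qed.

Lemma monomial_idealN x : monomial_ideal x -> monomial_ideal (- x).
Proof.
by rewrite -sub0r => Jx; apply: monomial_idealB Jx; apply: monomial_ideal0.
Qed.

Lemma monomial_idealD x y :
  monomial_ideal x -> monomial_ideal y -> monomial_ideal (x + y).
Proof.
move=> Jx Jy; rewrite -[y]opprK.
by apply: monomial_idealB Jx _; apply: monomial_idealN.
Qed.

Lemma monomial_idealMl a x : monomial_ideal x -> monomial_ideal (a * x).
Proof. by have [_ _ J] := monomial_idealP => /(J a _ 1); rewrite mulr1. Qed.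

Lemma monomial_idealMr a x : monomial_ideal x -> monomial_ideal (x * a).
Proof. by have [_ _ J] := monomial_idealP => /(J 1 _ a); rewrite mul1r. Qed.

Lemma monomial_idealZ c x : monomial_ideal x -> monomial_ideal (c *: x).
Proof. by move=> Jx; rewrite -mul_malgC; apply: monomial_idealMl. Qed.

Lemma monomial_ideal1 : ~ monomial_ideal 1.
Proof.
move=> /(_ [set x | mcoeff mone x = 0]) h.
suff: mcoeff mone (1 : free_algebra k 'I_d) = 0.
  by rewrite rmorph1 => /eqP; rewrite oner_eq0.
apply: h; split; first split=> [|x y /= x0 y0|a x b /= x0].
- by rewrite /= mcoeff0.
- by rewrite mcoeffB x0 y0 subr0.
- by rewrite !rmorphM /= x0 mulr0 mul0r.
move=> _ [w Ww <-] /=; rewrite /word mcoeffU1.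
by case: eqP => // w1; case: (relations_neq1 (m := W)); rewrite -w1.
Qed.

Definition monomial_equiv : rel (free_algebra k 'I_d) :=
  fun x y => `[< monomial_ideal (x - y) >].

Lemma monomial_equiv_is_equiv : equiv_class_of monomial_equiv.
Proof.
split=> [x|x y|y x z].
- by apply/asboolP; rewrite subrr; apply: monomial_ideal0.
- by apply/asbool_equiv_eq; split=> /monomial_idealN; rewrite opprB.
- move=> /asboolP xy /asboolP yz; apply/asboolP.
  by rewrite -(subrKA y); apply: monomial_idealD.
Qed.

Canonical monomial_equiv_equiv := EquivRelPack monomial_equiv_is_equiv.
Canonical monomial_equiv_encModRel := defaultEncModRel monomial_equiv.

Definition monomial_algebra : Type := {eq_quot monomial_equiv}.

HB.instance Definition _ := Choice.on monomial_algebra.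
HB.instance Definition _ := EqQuotient.on monomial_algebra.

Local Notation A := monomial_algebra.

Lemma mquotE (x y : free_algebra k 'I_d) :
  (\pi_A x = \pi_A y) <-> monomial_ideal (x - y).
Proof. by split=> [/eqmodP/asboolP|J]; last exact/eqmodP/asboolP. Qed.

Lemma mquot_repr (x : free_algebra k 'I_d) : monomial_ideal (x - repr (\pi_A x)).
Proof. by apply/mquotE; rewrite reprK. Qed.

Definition mquot_add (a b : A) : A := \pi_A (repr a + repr b).
Definition mquot_opp (a : A) : A := \pi_A (- repr a).
Definition mquot_mul (a b : A) : A := \pi_A (repr a * repr b).
Definition mquot_scale (c : k) (a : A) : A := \pi_A (c *: repr a).

Lemma mquot_piD x y : mquot_add (\pi_A x) (\pi_A y) = \pi_A (x + y).
Proof.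
apply/esym/mquotE; rewrite opprD addrACA.
exact: monomial_idealD (mquot_repr _) (mquot_repr _).
Qed.

Lemma mquot_piN x : mquot_opp (\pi_A x) = \pi_A (- x).
Proof. by apply/esym/mquotE; rewrite -opprD; apply: monomial_idealN; apply: mquot_repr. Qed.

Lemma mquot_piM x y : mquot_mul (\pi_A x) (\pi_A y) = \pi_A (x * y).
Proof.
apply/esym/mquotE; rewrite -(subrKA (x * repr (\pi_A y))) -mulrBr -mulrBl.
apply: monomial_idealD.
  by apply: monomial_idealMl; apply: mquot_repr.
by apply: monomial_idealMr; apply: mquot_repr.
Qed.

Lemma mquot_piZ c x : mquot_scale c (\pi_A x) = \pi_A (c *: x).
Proof.
by apply/esym/mquotE; rewrite -scalerBr; apply: monomial_idealZ; apply: mquot_repr.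
Qed.

Lemma mquotP (P : A -> Prop) : (forall x, P (\pi_A x)) -> forall a, P a.
Proof. by move=> h a; rewrite -[a]reprK. Qed.

Fact mquot_addA : associative mquot_add.
Proof.
by elim/mquotP=> x; elim/mquotP=> y; elim/mquotP=> z; rewrite !mquot_piD addrA.
Qed.

Fact mquot_addC : commutative mquot_add.
Proof. by elim/mquotP=> x; elim/mquotP=> y; rewrite !mquot_piD addrC. Qed.

Fact mquot_add0 : left_id (\pi_A 0) mquot_add.
Proof. by elim/mquotP=> x; rewrite mquot_piD add0r. Qed.

Fact mquot_addN : left_inverse (\pi_A 0) mquot_opp mquot_add.
Proof. by elim/mquotP=> x; rewrite mquot_piN mquot_piD addNr. Qed.

HB.instance Definition _ := GRing.isZmodule.Build monomial_algebra
  mquot_addA mquot_addC mquot_add0 mquot_addN.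

Fact mquot_mulA : associative mquot_mul.
Proof.
by elim/mquotP=> x; elim/mquotP=> y; elim/mquotP=> z; rewrite !mquot_piM mulrA.
Qed.

Fact mquot_mul1r : left_id (\pi_A 1) mquot_mul.
Proof. by elim/mquotP=> x; rewrite mquot_piM mul1r. Qed.

Fact mquot_mulr1 : right_id (\pi_A 1) mquot_mul.
Proof. by elim/mquotP=> x; rewrite mquot_piM mulr1. Qed.

Fact mquot_mulDl : left_distributive mquot_mul mquot_add.
Proof.
elim/mquotP=> x; elim/mquotP=> y; elim/mquotP=> z.
by rewrite !(mquot_piM, mquot_piD) mulrDl.
Qed.

Fact mquot_mulDr : right_distributive mquot_mul mquot_add.
Proof.
elim/mquotP=> x; elim/mquotP=> y; elim/mquotP=> z.
by rewrite !(mquot_piM, mquot_piD) mulrDr.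
Qed.

Fact mquot_1neq0 : \pi_A 1 != 0.
Proof. by apply/eqP=> /mquotE; rewrite subr0; apply: monomial_ideal1. Qed.

HB.instance Definition _ := GRing.Zmodule_isNzRing.Build monomial_algebra
  mquot_mulA mquot_mul1r mquot_mulr1 mquot_mulDl mquot_mulDr mquot_1neq0.

Fact mquot_scaleA c1 c2 a :
  mquot_scale c1 (mquot_scale c2 a) = mquot_scale (c1 * c2) a.
Proof. by elim/mquotP: a => x; rewrite !mquot_piZ scalerA. Qed.

Fact mquot_scale1 : left_id 1 mquot_scale.
Proof. by elim/mquotP=> x; rewrite mquot_piZ scale1r. Qed.

Fact mquot_scaleDr : right_distributive mquot_scale +%R.
Proof.
move=> c; elim/mquotP=> x; elim/mquotP=> y.
by rewrite [X in mquot_scale _ X]mquot_piD !mquot_piZ [RHS]mquot_piD scalerDr.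
Qed.

Fact mquot_scaleDl a : {morph mquot_scale^~ a : c1 c2 / c1 + c2}.
Proof.
by elim/mquotP: a => x c1 c2 /=; rewrite !mquot_piZ [RHS]mquot_piD scalerDl.
Qed.

HB.instance Definition _ := GRing.Zmodule_isLmodule.Build k monomial_algebra
  mquot_scaleA mquot_scale1 mquot_scaleDr mquot_scaleDl.

Fact mquot_scaleAl (c : k) (a b : A) : c *: (a * b) = (c *: a) * b.
Proof.
elim/mquotP: a => x; elim/mquotP: b => y.
rewrite [_ * _ in LHS]mquot_piM [LHS]mquot_piZ [c *: _ in RHS]mquot_piZ.
by rewrite [RHS]mquot_piM scalerAl.
Qed.

HB.instance Definition _ :=
  GRing.Lmodule_isLalgebra.Build k monomial_algebra mquot_scaleAl.

Fact malg_scaleAr (c : k) (x y : free_algebra k 'I_d) :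
  c *: (x * y) = x * (c *: y).
Proof.
have commC : mkmalgU mone c * x = x * mkmalgU mone c.
  rewrite [LHS]fgmulUg [RHS]fgmulgU; apply: eq_bigr => w _.
  by rewrite mulrC mul1m mulm1.
by rewrite -!mul_malgC mulrA commC mulrA.
Qed.

Fact mquot_scaleAr (c : k) (a b : A) : c *: (a * b) = a * (c *: b).
Proof.
elim/mquotP: a => x; elim/mquotP: b => y.
rewrite [_ * _ in LHS]mquot_piM [LHS]mquot_piZ [c *: _ in RHS]mquot_piZ.
by rewrite [RHS]mquot_piM malg_scaleAr.
Qed.

HB.instance Definition _ :=
  GRing.Lalgebra_isAlgebra.Build k monomial_algebra mquot_scaleAr.

Definition monomial (w : fmonom 'I_d) : monomial_algebra := \pi_A (word k w).

Definition monomial_grading (i : nat) : set monomial_algebra :=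
  [set \pi_A x | x in
    [set x : free_algebra k 'I_d | forall w, mcoeff w x != 0 -> fdeg w = i]].

End MonomialAlgebra.

Section Dimension.
Variables (k : fieldType) (V : lmodType k).

Definition is_basis (S : set V) (n : nat) (b : 'I_n -> V) : Prop :=
  (forall c : 'I_n -> k, \sum_i c i *: b i = 0 -> forall i, c i = 0) /\
  S = [set \sum_i c i *: b i | c in [set: 'I_n -> k]].

(* Dimension of a finite-dimensional subspace S; 0 when S has no finite basis. *)
Definition dimension (S : set V) : nat :=
  xget 0%N [set n | exists b : 'I_n -> V, is_basis S b].

(* The sum, inside V, of the pieces of degree at most n; it is direct when Vgr
   is a grading of V. *)
Definition truncation (Vgr : nat -> set V) (n : nat) : set V :=
  [set \sum_i v i | v in
    [set v : 'I_n.+1 -> V | forall i : 'I_n.+1, Vgr i (v i)]].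

(* The sequence is bounded, as limn_sup requires, whenever V is a finitely
   generated graded algebra. *)
Definition entropy (R : realType) (Vgr : nat -> set V) : R :=
  limn_sup (fun n => (dimension (truncation Vgr n))%:R `^ n%:R^-1).

End Dimension.

Definition log2 (R : realType) (x : R) : R := ln x / ln 2.

Definition freely_generate (k : fieldType) (A : algType k) (a b : A) : Prop :=
  exists phi : {lrmorphism free_algebra k bool -> A},
    [/\ phi (word k (fmu false)) = a, phi (word k (fmu true)) = b
      & injective phi].

(* Main.v *)
(* Fix m and impose on k<x, y> the monomial relations killing every word in
   which two occurrences of y sit at positions that differ modulo m.  A
   surviving word of length n is a choice of residue r mod m together with a
   subset of the roughly n/m positions congruent to r.  Counting the words of
   length at most n gives between 2^(n/m) and 4 m^2 2^(n/m) basis elements, so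
   the entropy is exactly 2^(1/m).  The two monomials x^m and x^(m-1) y have
   degree m = 1 / log2 (2^(1/m)), form a uniform-length code, and all their
   products survive, hence they freely generate a free subalgebra. *)
Require Import Defs.
From HB Require Import structures.
From mathcomp Require Import all_boot all_order all_algebra.
From mathcomp Require Import all_classical all_reals all_analysis.
From mathcomp Require Import -(notations) finmap.
From mathcomp.multinomials Require Import -(notations) monalg.

Set Implicit Arguments.
Unset Strict Implicit.
Unset Printing Implicit Defensive.

Import Order.TTheory GRing.Theory Num.Theory.
Import numFieldNormedType.Exports.
Local Open Scope classical_set_scope.
Local Open Scope ring_scope.

(** * Free algebras: expansion on words and the universal property *)

Section FreeAlgebra.
Variables (k : fieldType) (I : choiceType).

Lemma word_mul (v w : fmonom I) : word k v * word k w = word k (mmul v w).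
Proof. by rewrite [LHS]fgmulUU mulr1. Qed.

Lemma mcoeff_word (v w : fmonom I) : mcoeff v (word k w) = (w == v)%:R.
Proof. exact: mcoeffU1. Qed.

Lemma free_algebraE (x : free_algebra k I) :
  x = \sum_(w <- msupp x) mcoeff w x *: word k w.
Proof.
rewrite [LHS]monalgE; apply: eq_bigr => w _; apply/malgP => v.
by rewrite mcoeffZ mcoeffU1 mcoeffU mulr_natr.
Qed.

Lemma linear_free_algebraE (V : lmodType k)
    (phi : {linear free_algebra k I -> V}) (x : free_algebra k I) :
  phi x = \sum_(w <- msupp x) mcoeff w x *: phi (word k w).
Proof.
rewrite {1}(free_algebraE x) linear_sum.
by apply: eq_bigr => w _; rewrite linearZ.
Qed.

Variables (A : algType k) (f : I -> A).

Let eval (w : fmonom I) : A := \prod_(i <- (w : seq I)) f i.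

Fact eval_mmorphism : mmorphism eval.
Proof.
split=> [v w|]; first by rewrite /eval fmM big_cat.
by rewrite /eval fm1 big_nil.
Qed.

HB.instance Definition _ :=
  isMultiplicative.Build (fmonom I) A eval eval_mmorphism.

Let lift : free_algebra k I -> A := mmap (in_alg A) eval.

Let lift_linear : linear lift.
Proof. by move=> c x y; rewrite /lift mmapD mmapZ /= mulr_algl. Qed.

Let lift_monoid : monoid_morphism lift.
Proof.
have [liftM lift1] : multiplicative lift.
  (* Scalars are central in [A], so they commute with the images of words. *)
  apply: commr_mmap_is_multiplicative => x v w.
  by rewrite /GRing.comm mulr_algl mulr_algr.
by split.
Qed.

HB.instance Definition _ := GRing.isLinear.Build k _ A *:%R lift lift_linear.
HB.instance Definition _ := GRing.isMonoidMorphism.Build _ A lift lift_monoid.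

Lemma free_algebra_lift : exists phi : {lrmorphism free_algebra k I -> A},
  forall w, phi (word k w) = \prod_(i <- (w : seq I)) f i.
Proof. by exists lift => w; rewrite /= /lift mmapU /= scale1r mul1r. Qed.

End FreeAlgebra.

(** * Monomial algebras: monomial bases and free subalgebras *)

Section MonomialAlgebraTheory.
Variables (k : fieldType) (d : nat) (W : monomial_relations d).

Local Notation A := (monomial_algebra k W).

(** Naming the projection lets it carry a linear structure. *)
Definition mquot_pi (x : free_algebra k 'I_d) : A := (\pi_A x)%qT.

Fact mquot_pi_linear : linear mquot_pi.
Proof.
move=> c x y; apply/esym; rewrite /mquot_pi.
by rewrite [_ *: _ in LHS]mquot_piZ [LHS]mquot_piD.
Qed.

HB.instance Definition _ :=
  GRing.isLinear.Build k _ A *:%R mquot_pi mquot_pi_linear.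

Lemma monomial_mul (v w : fmonom 'I_d) :
  monomial k W v * monomial k W w = monomial k W (mmul v w).
Proof. by rewrite [LHS]mquot_piM word_mul. Qed.

Lemma sum_monomial (T : Type) (r : seq T) (P : pred T) (c : T -> k)
    (h : T -> fmonom 'I_d) :
  \sum_(t <- r | P t) c t *: monomial k W (h t) =
  mquot_pi (\sum_(t <- r | P t) c t *: word k (h t)).
Proof. by rewrite linear_sum; apply: eq_bigr => t _; rewrite linearZ. Qed.

Hypothesis W_closed :
  forall a w b, relations W w -> relations W (mmul a (mmul w b)).

(** As [W] is stable under multiplication by words on both sides, the elements supported on [W]
    already form a two-sided ideal, and minimality of the generated ideal applies to it. *)
Lemma monomial_idealE (x : free_algebra k 'I_d) :
  monomial_ideal W x <-> forall w, mcoeff w x != 0 -> relations W w.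
Proof.
split=> [|Wx]; last first.
  rewrite (free_algebraE x) big_seq.
  apply: (big_ind (monomial_ideal W)); first exact: monomial_ideal0.
    exact: monomial_idealD.
  move=> w wx; apply: monomial_idealZ => J [_]; apply.
  by exists w => //; apply: Wx; rewrite mcoeff_neq0.
move=> /(_ [set x | forall w, mcoeff w x != 0 -> relations W w]); apply.
split; last first.
  move=> _ [w Ww <-] v /=; rewrite mcoeff_word.
  by have [<-|_] := eqVneq w v; rewrite ?eqxx.
split=> [w|y z Wy Wz w|a y b Wy w] /=; first by rewrite mcoeff0 eqxx.
  rewrite mcoeffB => yz; have [y0|] := eqVneq (mcoeff w y) 0; last exact: Wy.
  by apply: Wz; apply: contra_neq yz => ->; rewrite y0 subr0.
rewrite mcoeff_neq0 => /msuppM_le[u [v [/msuppM_le[u1 [u2 [_ yu ->]]] _ ->]]].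
by rewrite -mulmA; apply: W_closed; apply: Wy; rewrite mcoeff_neq0.
Qed.

Lemma mquot_pi_eq0 x :
  mquot_pi x = 0 <-> forall w, mcoeff w x != 0 -> relations W w.
Proof.
rewrite -monomial_idealE -[in X in _ <-> X](subr0 x).
exact: (mquotE W x 0).
Qed.

(** Since [h] is injective, the lifted sum has coefficient [c t] at [h t]; were it nonzero, [h t]
    would be a relation. *)
Lemma monomial_free (T : eqType) (r : seq T) (c : T -> k)
    (h : T -> fmonom 'I_d) :
    uniq r -> injective h -> (forall t, ~ relations W (h t)) ->
  \sum_(t <- r) c t *: monomial k W (h t) = 0 -> {in r, forall t, c t = 0}.
Proof.
move=> r_uniq h_inj Wh; rewrite sum_monomial => /mquot_pi_eq0 sumW t tr.
apply: contra_notP (Wh t) => /eqP ct; apply: sumW.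
rewrite raddf_sum /= (bigD1_seq t) //= big1 ?addr0 => [|s st].
  by rewrite mcoeffZ mcoeff_word eqxx mulr1.
by rewrite mcoeffZ mcoeff_word (inj_eq h_inj) (negbTE st) mulr0.
Qed.

(** The monoid morphism extending [f]; it is injective exactly when the words [f i] form a code. *)
Definition subst_word (I : choiceType) (f : I -> fmonom 'I_d) (w : fmonom I) :
  fmonom 'I_d := \big[mmul/mone]_(i <- (w : seq I)) f i.

(** Distinct words in the two generators map to distinct surviving monomials, which are linearly
    independent, so the induced morphism has trivial kernel. *)
Lemma freely_generate_monomials (u v : fmonom 'I_d)
    (s := subst_word (fun b => if b then v else u)) :
    injective s -> (forall w, ~ relations W (s w)) ->
  freely_generate (monomial k W u) (monomial k W v).
Proof.
move=> s_inj Ws; pose f b := monomial k W (if b then v else u).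
have [phi phi_word] := free_algebra_lift f.
have phiE w : phi (word k w) = monomial k W (s w).
  rewrite phi_word /s /subst_word.
  by elim/big_rec2: _ => // b y _ _ ->; rewrite monomial_mul.
exists phi; split; try by rewrite phi_word fmU big_seq1.
suff phi_ker x : phi x = 0 -> x = 0 by apply: raddf_inj => x; apply: phi_ker.
rewrite linear_free_algebraE.
rewrite (eq_bigr (fun w => mcoeff w x *: monomial k W (s w))); last first.
  by move=> w _; congr (_ *: _); apply: phiE.
move=> phix0; apply/malgP => w; rewrite mcoeff0.
have [wx|/mcoeff_outdom//] := boolP (w \in msupp x).
by apply: (monomial_free _ _ _ phix0) => //; apply: fset_uniq.
Qed.

Lemma truncation_basis n (ws : seq (fmonom 'I_d)) :
    uniq ws -> (forall w, w \in ws <-> ~ relations W w /\ (fdeg w <= n)%N) ->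
  is_basis (truncation (@monomial_grading k d W) n)
    (fun i : 'I_(size ws) => monomial k W (tnth (in_tuple ws) i)).
Proof.
move=> ws_uniq wsE.
have h_inj : injective (tnth (in_tuple ws)) by apply/tuple_uniqP.
have hP i : ~ relations W (tnth (in_tuple ws) i) /\
    (fdeg (tnth (in_tuple ws) i) <= n)%N.
  by apply/wsE; apply: mem_tnth.
split=> [c c0 i|].
  have Wh j : ~ relations W (tnth (in_tuple ws) j) by have [] := hP j.
  by apply: (monomial_free (index_enum_uniq _) h_inj Wh c0);
     rewrite mem_index_enum.
apply/seteqP; split=> [_ [v vP <-]|_ [c _ <-]].
  have /choice[x xP] (i : 'I_n.+1) : exists x : free_algebra k 'I_d,
      (forall w, mcoeff w x != 0 -> fdeg w = i) /\ mquot_pi x = v i.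
    by have [x ? <-] := vP i; exists x.
  (* The coordinates are read off a lift [y] of the whole sum; what remains of [y] must lie in the
     ideal. *)
  pose y := \sum_i x i.
  exists (fun i => mcoeff (tnth (in_tuple ws) i) y) => //.
  rewrite sum_monomial (eq_bigr (fun i => mquot_pi (x i))); last first.
    by move=> i _; have [_ ->] := xP i.
  rewrite -raddf_sum -/y; apply/eqP; rewrite -subr_eq0 -linearB; apply/eqP.
  apply/mquot_pi_eq0 => w; rewrite mcoeffB raddf_sum /=.
  (* A surviving word of degree at most [n] is listed exactly once, so its coefficients cancel. A
     longer word occurs neither in the list nor in [y]. *)
  apply: contra_neqP => Ww; have [wn|nw] := leqP (fdeg w) n.
    have /tnthP[i ->] : w \in in_tuple ws by apply/wsE.
    rewrite (bigD1 i) //= big1 ?addr0 => [|j ji].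
      by rewrite mcoeffZ mcoeff_word eqxx mulr1 subrr.
    by rewrite mcoeffZ mcoeff_word (inj_eq h_inj) (negbTE ji) mulr0.
  rewrite big1 => [|i _]; last first.
    rewrite mcoeffZ mcoeff_word; case: eqP => [iw|]; last by rewrite mulr0.
    by have [_] := hP i; rewrite iw leqNgt nw.
  rewrite sub0r raddf_sum big1 ?oppr0 //= => i _.
  apply/eqP; apply: contraTT nw => /(proj1 (xP i)) ->.
  by rewrite -leqNgt -ltnS.
(* Conversely, a combination of listed monomials splits into homogeneous parts by grouping its terms
   by degree. *)
exists (fun i : 'I_n.+1 =>
  \sum_(j | fdeg (tnth (in_tuple ws) j) == i)
    c j *: monomial k W (tnth (in_tuple ws) j)).
  move=> i /=; rewrite sum_monomial; eexists; last by [].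
  move=> w; rewrite raddf_sum /=.
  apply: contra_neq_eq => wi; apply: big1 => j /eqP ji.
  rewrite mcoeffZ mcoeff_word; case: eqP => [jw|]; last by rewrite mulr0.
  by rewrite -jw ji eqxx in wi.
have deg_lt j : (fdeg (tnth (in_tuple ws) j) < n.+1)%N by have [] := hP j.
rewrite [RHS](partition_big (fun j => Ordinal (deg_lt j)) xpredT) //.
Qed.

End MonomialAlgebraTheory.

(** * Dimension as the common size of all bases *)

Section Dimension.
Variables (k : fieldType) (V : lmodType k).

(** The matrix expressing the free family [b] in the spanning family [c] has independent rows, hence
    at most as many rows as columns. *)
Lemma basis_size_le (S : set V) (p q : nat) (b : 'I_p -> V) (c : 'I_q -> V) :
  is_basis S b -> is_basis S c -> (p <= q)%N.
Proof.
move=> [b_free Sb] [_ Sc].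
have /choice[M bM] i : exists a : 'I_q -> k, \sum_j a j *: c j = b i.
  have : S (b i).
    rewrite Sb; exists (fun j => (i == j)%:R) => //.
    rewrite (bigD1 i) //= eqxx scale1r big1 ?addr0 // => j ji.
    by rewrite eq_sym (negbTE ji) scale0r.
  by rewrite Sc => -[a _ <-]; exists a.
suff /eqP <- : row_free (\matrix_(i, j) M i j) by apply: rank_leq_col.
apply: inj_row_free => v vM; apply/rowP => i; rewrite mxE.
apply: (b_free (v 0)) => {i}.
under eq_bigr do rewrite -bM scaler_sumr.
rewrite exchange_big big1 //= => j _.
under eq_bigr do rewrite scalerA.
have /rowP/(_ j) := vM; rewrite !mxE => vMj.
rewrite -scaler_suml (_ : \sum_i _ = 0) ?scale0r // -[RHS]vMj.
by apply: eq_bigr => i _; rewrite mxE.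
Qed.

Lemma dimension_basis (S : set V) (n : nat) (b : 'I_n -> V) :
  is_basis S b -> dimension S = n.
Proof.
move=> Sb; apply: xget_unique; first by exists b.
move=> p [c Sc]; apply/eqP.
by rewrite eqn_leq (basis_size_le Sc Sb) (basis_size_le Sb Sc).
Qed.

End Dimension.

(** * Combinatorics and counting of aligned words *)

Section AlignedWords.
Local Open Scope nat_scope.
Variable m' : nat.
Local Notation m := m'.+1.

(* The letters x and y are [ord0] and [ord_max]; as x is also the default of
   [nth], positions beyond the end of [w] impose nothing. *)
Definition aligned (w : seq 'I_2) : Prop := forall p q,
  nth ord0 w p = ord_max -> nth ord0 w q = ord_max -> p = q %[mod m].

Fact aligned_nil : ~ ~ aligned (mone : fmonom 'I_2).
Proof. by apply; rewrite fm1 => p q; rewrite nth_nil. Qed.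

Definition misaligned : monomial_relations 2 :=
  @MonomialRelations 2 [set w : fmonom 'I_2 | ~ aligned w] aligned_nil.

(** Passing to a factor shifts every position by [size a], which preserves congruences. *)
Lemma aligned_factor (a w b : seq 'I_2) : aligned (a ++ w ++ b) -> aligned w.
Proof.
have nth_factor p : nth ord0 w p = ord_max ->
    nth ord0 (a ++ w ++ b) (size a + p) = ord_max.
  rewrite nth_cat ltnNge leq_addr addKn nth_cat /=.
  by case: ltnP => // wp; rewrite nth_default.
move=> al p q /nth_factor pw /nth_factor qw; apply/eqP.
by rewrite -(eqn_modDl (size a)); apply/eqP/al.
Qed.

Lemma misaligned_closed a w b :
  relations misaligned w -> relations misaligned (mmul a (mmul w b)).
Proof. by apply: contra_not; rewrite !fmM; apply: aligned_factor. Qed.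

(** For [r < m], bit [i] of [t] chooses the letter at position [i * m + r], bits past the end
    counting as false; all other positions hold x. *)
Definition spread (r n : nat) (t : seq bool) : seq 'I_2 :=
  mkseq (fun p => if (p %% m == r) && nth false t (p %/ m)
                  then ord_max else ord0) n.

Lemma size_spread r n t : size (spread r n t) = n.
Proof. exact: size_mkseq. Qed.

Lemma nth_spread r n t p : (p < n) -> nth ord0 (spread r n t) p =
  if (p %% m == r) && nth false t (p %/ m) then ord_max else ord0.
Proof. exact: nth_mkseq. Qed.

Lemma spread_aligned r n t : aligned (spread r n t).
Proof.
have mod_r p : nth ord0 (spread r n t) p = ord_max -> (p %% m) = r.
  have [pn|np] := ltnP p n; last by rewrite nth_default ?size_spread.
  by rewrite nth_spread //; case: eqP.
by move=> p q /mod_r -> /mod_r ->.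
Qed.

(** The length bound keeps position [i * m + r] inside the word for every bit [i], so each bit can
    be read back. *)
Lemma spread_inj r n s t : (r < m) -> size s = size t ->
  (size s * m <= n) -> spread r n s = spread r n t -> s = t.
Proof.
move=> rm st sn eq_st; apply: (eq_from_nth (x0 := false)) => // i i_s.
have ilt : (i * m + r < n).
  apply: leq_trans sn; apply: leq_trans (_ : i.+1 * m <= _).
    by rewrite mulSn addnC ltn_add2r.
  by rewrite leq_mul2r i_s orbT.
have := congr1 (nth ord0 ^~ (i * m + r)) eq_st; rewrite !nth_spread //.
rewrite modnMDl modn_small // eqxx divnMDl // divn_small // addn0 /=.
by case: (nth _ s i); case: (nth _ t i).
Qed.

(** The extra bit in the tuple covers the last, possibly incomplete, group of [m] positions. *)
Lemma aligned_spread (w : seq 'I_2) : aligned w ->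
  exists (r : 'I_m) (t : (size w %/ m).+1.-tuple bool), w = spread r (size w) t.
Proof.
move=> w_al; have [r r_mod] : exists r : 'I_m, forall p,
    nth ord0 w p = ord_max -> (p %% m) = r.
  have [[p0 p0w]|none] := pselect (exists p, nth ord0 w p = ord_max).
    by exists (Ordinal (ltn_pmod p0 (ltn0Sn m'))) => p pw; apply: w_al.
  (* A word without y fits any residue. *)
  by exists ord0 => p pw; case: none; exists p.
pose f i := nth ord0 w (i * m + r) == ord_max.
exists r, (tcast (size_mkseq f (size w %/ m).+1) (in_tuple (mkseq f _))).
rewrite val_tcast /=; apply: (eq_from_nth (x0 := ord0)) => [|p pw].
  by rewrite size_spread.
rewrite nth_spread // nth_mkseq ?ltnS ?leq_div2r // 1?ltnW // /f.
have [pr|pr] := eqVneq (p %% m) r; rewrite /=; last first.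
  case: (nth _ _ _) (r_mod p) pr => -[|[|//]] lt2 mod_p.
    by move=> _; apply: val_inj.
  by rewrite mod_p ?eqxx //; apply: val_inj.
rewrite -[in RHS]pr -divn_eq; case: eqP => // /eqP.
by case: (nth _ _ _) => -[|[|//]] lt2 neq; apply: val_inj => //.
Qed.

Definition block (b : bool) : fmonom 'I_2 :=
  FMonom (rcons (nseq m' ord0) (if b then ord_max else ord0)).

Lemma fdeg_block b : fdeg (block b) = m.
Proof. by rewrite fdegE size_rcons size_nseq. Qed.

(** Each block stores its letter in its last position, of residue [m'], so the bits of a product of
    blocks spell [w]. This gives both alignment and decodability. *)
Lemma subst_block (w : fmonom bool) :
  subst_word block w = spread m' (size w * m) w :> seq 'I_2.
Proof.
rewrite /subst_word; case: w => w /=; elim: w => [|b w IHw].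
  by rewrite big_nil fm1.
rewrite big_cons fmM IHw; apply: (eq_from_nth (x0 := ord0)) => [|p].
  by rewrite size_cat !size_spread size_rcons size_nseq mulSn.
rewrite size_cat size_spread size_rcons size_nseq => plt.
rewrite [in RHS]nth_spread ?mulSn // nth_cat size_rcons size_nseq.
have [pm|mp] := ltnP p m.
  rewrite modn_small // divn_small //= nth_rcons size_nseq nth_nseq.
  by move: pm; rewrite ltnS leq_eqVlt; case: ltngtP.
rewrite -[p in RHS](subnKC mp) modnDl divnDl ?dvdnn // divnn /=.
by rewrite nth_spread // ltn_subLR // addnC.
Qed.

Lemma subst_block_inj : injective (subst_word block).
Proof.
move=> v w eq_vw; have := congr1 (@fmonom_val _) eq_vw; rewrite !subst_block.
have sz : size v = size w.
  have := congr1 (size \o @fmonom_val _) eq_vw; rewrite /= !subst_block.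
  by rewrite !size_spread => /eqP; rewrite eqn_pmul2r // => /eqP.
by rewrite sz => /spread_inj eq_w; apply: val_inj; apply: eq_w; rewrite -?sz.
Qed.

Definition aligned_words (n : nat) : seq (fmonom 'I_2) :=
  [seq w : fmonom 'I_2 <- [seq FMonom (tval t) | i <- iota 0 n.+1,
                                            t <- enum {: i.-tuple 'I_2}]
                       | `[< aligned w >]].

Lemma mem_aligned_words n w :
  w \in aligned_words n <-> aligned w /\ (fdeg w <= n).
Proof.
rewrite mem_filter; split=> [/andP[/asboolP al /allpairsPdep]|[/asboolP -> wn]].
  move=> [i [t [+ _ wE]]]; rewrite mem_iota add0n ltnS => /= le_in; split=> //.
  by rewrite wE fdegE size_tuple.
apply/allpairsPdep; exists (size w), (in_tuple w); split=> //.
- by rewrite mem_iota add0n ltnS.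
- by rewrite mem_enum.
- by apply: val_inj.
Qed.

Lemma aligned_words_uniq n : uniq (aligned_words n).
Proof.
apply/filter_uniq/allpairs_uniq_dep => [|i _|]; first exact: iota_uniq.
  exact: enum_uniq.
move=> [i s] [j t] _ _ /= [st].
have ij : i = j by rewrite -(size_tuple s) -(size_tuple t) st.
by subst j; congr existT; apply: val_inj.
Qed.

(** Words of length exactly [n] with residue 0 are enough, each complete group of [m] positions
    offering one free bit. *)
Lemma size_aligned_words_ge n : (2 ^ (n %/ m) <= size (aligned_words n)).
Proof.
have <- : size [seq FMonom (spread 0 n t) | t : (n %/ m).-tuple bool] =
    2 ^ (n %/ m).
  by rewrite size_map -cardE card_tuple card_bool.
apply: uniq_leq_size => [|_ /mapP[t _ ->]].
  rewrite map_inj_uniq ?enum_uniq // => s t [] /spread_inj eq_st.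
  apply: val_inj; apply: eq_st; rewrite ?size_tuple //.
  exact: leq_trunc_div.
apply/mem_aligned_words; split; first exact: spread_aligned.
by rewrite fdegE size_spread.
Qed.

(** Pairs of a residue and a bit string cover the aligned words of each length; repetitions, such as
    the powers of x, only weaken the bound. *)
Lemma size_aligned_words_sum n :
  (size (aligned_words n) <= \sum_(0 <= i < n.+1) m * 2 ^ (i %/ m).+1).
Proof.
pose s := [seq FMonom (spread (val rt.1) i (tval rt.2)) | i <- iota 0 n.+1,
                 rt <- enum {: 'I_m * (i %/ m).+1.-tuple bool}].
apply: (@leq_trans (size s)).
  apply: uniq_leq_size => [|w /mem_aligned_words[/aligned_spread[r [t wE]] wn]].
    exact: aligned_words_uniq.
  apply/allpairsPdep; exists (size w), (r, t); split.
  - by rewrite mem_iota add0n ltnS.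
  - by rewrite mem_enum.
  - by apply: val_inj.
rewrite size_allpairs_dep sumnE big_map /index_iota subn0.
apply: leq_sum => i _.
by rewrite -cardE card_prod card_ord card_tuple card_bool.
Qed.

(** The exponent is constant on groups of [m] consecutive indices, which leaves a geometric sum:
    each new group at most doubles the bound. *)
Lemma sum_pow2_div q :
  (\sum_(0 <= i < q * m) 2 ^ (i %/ m).+1 <= m * 2 ^ q.+1).
Proof.
elim: q => [|q IHq]; first by rewrite big_geq.
rewrite (big_cat_nat (n := q * m)) //=; last by rewrite leq_mul2r leqnSn orbT.
rewrite expnS mul2n -addnn mulnDr leq_add //.
rewrite -{1}[(q * m)]add0n big_addn mulSn addnK.
rewrite (eq_big_nat _ _ (F2 := fun=> (2 ^ q.+1))) => [|i /andP[_ im]].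
  by rewrite sum_nat_const_nat subn0.
by rewrite addnC divnMDl // divn_small // addn0.
Qed.

Lemma size_aligned_words_le n :
  (size (aligned_words n) <= 4 * m ^ 2 * 2 ^ (n %/ m)).
Proof.
apply: leq_trans (size_aligned_words_sum n) _.
rewrite -big_distrr /=; set q := (n %/ m).
(* Rounding the range up to complete groups gives [m * (m * 2 ^ q.+2)], whence the constant
   [4 * m ^ 2]. *)
have lt_n : (n.+1 <= q.+1 * m) by rewrite ltn_ceil.
apply: (@leq_trans (m * (m * 2 ^ q.+2))); last first.
  by rewrite -[q.+2]/(2 + q) expnD mulnA mulnn mulnCA mulnA.
rewrite leq_mul2l /=; apply: leq_trans (sum_pow2_div q.+1).
by rewrite [leqRHS](big_cat_nat (n := n.+1)) //= leq_addr.
Qed.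

End AlignedWords.

(** * Limits of nth roots *)

Section RootGrowth.
Variable R : realType.
Implicit Types (K : R) (m n : nat).

Lemma root_const_cvg K : 0 < K -> K `^ n%:R^-1 @[n --> \oo] --> (1 : R).
Proof.
move=> K0.
have -> : (fun n => K `^ n%:R^-1) = fun n => expR (n%:R^-1 * ln K).
  by apply/funext => n; rewrite /powR gt_eqF.
rewrite -[X in _ --> X]expR0 -[X in expR X](mul0r (ln K)).
apply: continuous_cvg; first exact: continuous_expR.
apply: cvgMr_tmp; apply/gtr0_cvgV0; last exact: cvgr_idn.
by near=> n; rewrite ltr0n; near: n; exact: nbhs_infty_gt.
Unshelve. all: by end_near. Qed.

(** Replacing [n %/ m] by the real quotient costs a factor at most 2, and nth roots of the constants
    [2^-1] and [K] tend to 1. *)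
Lemma root_growth_cvg (m K : nat) (D : nat -> nat) :
    (0 < m)%N ->
    (forall n, (2 ^ (n %/ m) <= D n <= K * 2 ^ (n %/ m))%N) ->
  (D n)%:R `^ n%:R^-1 @[n --> \oo] --> (2 `^ m%:R^-1 : R).
Proof.
move=> m0 HD; have mR : 0 < m%:R :> R by rewrite ltr0n.
(* At [n = 0] the bounds read [1 <= D 0 <= K]. *)
have K0 : (0 < K)%N.
  by have /andP[/leq_trans h /h] := HD 0%N; rewrite div0n expn0 muln1.
have pow2E n : (0 < n)%N -> 2 `^ m%:R^-1 = (2 `^ (n%:R / m%:R)) `^ n%:R^-1 :> R.
  by move=> n0; rewrite -powRrM mulrAC divff ?mul1r // pnatr_eq0 -lt0n.
have root_le n : {in Num.nneg &, {homo @powR R ^~ n%:R^-1 : x y / x <= y}}.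
  by apply: ge0_ler_powR; rewrite invr_ge0.
have le1 n : (n %/ m)%:R <= n%:R / m%:R :> R.
  by rewrite ler_pdivlMr // -natrM ler_nat leq_trunc_div.
have le2 n : n%:R / m%:R <= (n %/ m).+1%:R :> R.
  by rewrite ler_pdivrMr // -natrM ler_nat ltnW // ltn_ceil.
apply: (@squeeze_cvgr _ _ _ _ (fun n => 2^-1 `^ n%:R^-1 * 2 `^ m%:R^-1)
                              (fun n => K%:R `^ n%:R^-1 * 2 `^ m%:R^-1)).
- near=> n; have n0 : (0 < n)%N by near: n; exact: nbhs_infty_gt.
  have /andP[Dge Dle] := HD n.
  rewrite (pow2E n n0) -!powRM ?invr_ge0 ?powR_ge0 //; apply/andP; split.
    apply: root_le; rewrite ?nnegrE ?mulr_ge0 ?invr_ge0 ?powR_ge0 //.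
    apply: (@le_trans _ _ (2 ^ (n %/ m))%:R); last by rewrite ler_nat.
    rewrite ler_pdivrMl // natrX -exprS -powR_mulrn //.
    by apply: ler_powR; rewrite ?ler1n.
  apply: root_le; rewrite ?nnegrE ?mulr_ge0 ?powR_ge0 //.
  apply: (@le_trans _ _ (K * 2 ^ (n %/ m))%:R); first by rewrite ler_nat.
  rewrite natrM ler_wpM2l // natrX -powR_mulrn //.
  by apply: ler_powR; rewrite ?ler1n.
- rewrite -[X in _ --> X]mul1r; apply: cvgMl.
  by apply: root_const_cvg; rewrite invr_gt0.
- rewrite -[X in _ --> X]mul1r; apply: cvgMl.
  by apply: root_const_cvg; rewrite ltr0n.
Unshelve. all: by end_near. Qed.

End RootGrowth.

(** * Entropy of the examples and conclusion *)

Lemma misaligned_entropy (k : fieldType) (R : realType) (j : nat) :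
  entropy R (@monomial_grading k 2 (misaligned j)) = 2 `^ j.+1%:R^-1.
Proof.
(* The upper limit is computed as a genuine limit, the dimensions being the numbers of aligned
   words. *)
apply: (cvg_limn_inf_sup _).2.
apply: (root_growth_cvg (K := 4 * j.+1 ^ 2)) => // n.
have wsE w :
    w \in aligned_words j n <-> ~ relations (misaligned j) w /\ (fdeg w <= n)%N.
  rewrite mem_aligned_words.
  by split=> -[al wn]; split=> //; apply: contrapT => // /(_ al).
rewrite (dimension_basis (truncation_basis k (@misaligned_closed j)
                            (aligned_words_uniq j n) wsE)).
by rewrite size_aligned_words_ge size_aligned_words_le.
Qed.

Theorem theorem3p3 (k : fieldType) (R : realType) :
  exists (C : R) (d : nat -> nat) (W : forall j, monomial_relations (d j)),
    let H j : R := entropy R (@monomial_grading k (d j) (W j)) in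
    [/\ 0 < C,
        forall j, 1 < H j,
        H j @[j --> \oo] --> (1 : R)
      & forall j, exists u v : fmonom 'I_(d j),
          [/\ (fdeg u)%:R <= C / log2 (H j),
              (fdeg v)%:R <= C / log2 (H j)
            & freely_generate (monomial k (W j) u) (monomial k (W j) v)]].
Proof.
(* The modulus is [j.+1], so [log2 (H j)] is the inverse of [j.+1], the degree of both blocks: the
   bound with constant 1 is an equality. *)
exists 1, (fun=> 2), misaligned => H.
have HE j : H j = 2 `^ j.+1%:R^-1 by exact: misaligned_entropy.
have deg_le j b : (fdeg (block j b))%:R <= 1 / log2 (H j).
  rewrite fdeg_block HE /log2 ln_powR mulfK ?invrK ?mul1r //.
  by rewrite gt_eqF // ln_gt0 // ltr1n.
split=> // [j||j].
- have : 1 `^ j.+1%:R^-1 < 2 `^ j.+1%:R^-1 :> R.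
    by apply: gt0_ltr_powR; rewrite ?nnegrE ?invr_gt0 ?ltr1n.
  by rewrite HE powR1.
- rewrite (_ : H = fun j => 2 `^ j.+1%:R^-1); last exact/funext.
  have := root_const_cvg (ltr0Sn R 1).
  by rewrite -cvg_shiftS.
exists (block j false), (block j true); split; try exact: deg_le.
have blockE : (fun b => if b then block j true else block j false) = block j.
  by apply/funext => -[].
apply: freely_generate_monomials; rewrite ?blockE.
- exact: misaligned_closed.
- exact: subst_block_inj.
(* Products of blocks are spread words, hence aligned, and so survive. *)
- by move=> w /=; apply; rewrite subst_block; apply: spread_aligned.
Qed.
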